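(* Let $d\ge1$ and $n\ge2$. For $1\le k\le n$, let $\Theta_{n,d,k}$ denote the class of all $n$-tuples $(\theta_1,\dots,\theta_n)$ with each $\theta_i\in\mathbb{R}^d$ such that the number of distinct vectors among $\theta_1,\dots,\theta_n$ is equal to $k$. Let $X_1,\dots,X_n$ be independent with $X_i\sim N(\theta_i,I_d)$, and define $$\mathcal{R}^*(\Theta_{n,d,k}):=\inf_{\tilde\theta_1,\dots,\tilde\theta_n}\ \sup_{(\theta_1,\dots,\theta_n)\in\Theta_{n,d,k}}\mathbb{E}\left[\frac1n\sum_{i=1}^n\|\tilde\theta_i-\hat\theta_i^*\|^2\right],$$ where the infimum is over all estimators $\tilde\theta_1,\dots,\tilde\theta_n$ based on the observations $X_1,\dots,X_n$, and $$\hat\theta_i^*:=X_i+\frac{\nabla f_{\bar G_n}(X_i)}{f_{\bar G_n}(X_i)},$$ with $\bar G_n$ the empirical measure of $\theta_1,\dots,\theta_n$. Then there exists a universal positive constant $C$ such that $$\mathcal{R}^*(\Theta_{n,d,k})\ge C\,\frac kn\qquad\text{for every }1\le k\le n.$$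
   Context: $\|\cdot\|$ is the Euclidean norm, $\phi_d(z):=(2\pi)^{-d/2}\exp(-\|z\|^2/2)$, and for a probability measure $G$ on $\mathbb{R}^d$, $f_G(x):=\int\phi_d(x-\theta)\,dG(\theta)$. *)

(* Defs.v *)
From HB Require Import structures.
From mathcomp Require Import all_boot all_order all_algebra.
From mathcomp Require Import all_classical all_reals all_analysis.

Set Implicit Arguments.
Unset Strict Implicit.
Unset Printing Implicit Defensive.

Import Order.TTheory GRing.Theory Num.Theory.
Import numFieldNormedType.Exports.

Local Open Scope classical_set_scope.
Local Open Scope ring_scope.

Definition rV_display : measure_display -> measure_display.
Proof. exact. Qed.

(* R^d is 'rV[R]_d with its Borel sigma-algebra, generated by the d coordinate
   maps, in the same way as the library does for n.-tuple T. *)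
Section measurable_rV.
Context {R : realType} {d : nat}.

Let coord (j : 'I_d) (x : 'rV[R]_d) : R := x ord0 j.

Let rV_set0 : g_sigma_preimage coord set0.
Proof. exact: sigma_algebra0. Qed.

Let rV_setC A : g_sigma_preimage coord A -> g_sigma_preimage coord (~` A).
Proof. exact: sigma_algebraC. Qed.

Let rV_bigcup (F : _^nat) : (forall i, g_sigma_preimage coord (F i)) ->
  g_sigma_preimage coord (\bigcup_i (F i)).
Proof. exact: sigma_algebra_bigcup. Qed.

HB.instance Definition _ :=
  @isMeasurable.Build (rV_display default_measure_display)
    'rV[R]_d (g_sigma_preimage coord) rV_set0 rV_setC rV_bigcup.

Lemma measurable_rV_coord (j : 'I_d) :
  measurable_fun [set: 'rV[R]_d] (fun x : 'rV[R]_d => x ord0 j).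
Proof.
move=> _ Y mY; rewrite setTI; apply: sub_sigma_algebra => /=.
rewrite -bigcup_seq/=; exists j => /=; first by rewrite mem_index_enum.
by exists Y => //; rewrite setTI.
Qed.

Definition row_of_tuple (t : d.-tuple (measurableTypeR R)) : 'rV[R]_d := \row_j tnth t j.

Lemma measurable_row_of_tuple : measurable_fun [set: d.-tuple (measurableTypeR R)] row_of_tuple.
Proof.
have prefS : g_sigma_preimage coord `<=`
    [set A | measurable (row_of_tuple @^-1` A)].
  apply: smallest_sub.
    split=> [|A|F] /=.
    - by rewrite preimage_set0.
    - by move=> mA; rewrite setTD preimage_setC; exact: measurableC.
    - by move=> mF; rewrite preimage_bigcup; exact: bigcup_measurable.
  rewrite -bigcup_seq => A [j _ [B mB <-]] /=.
  rewrite setTI (_ : _ @^-1` _ = (fun t : d.-tuple (measurableTypeR R) => tnth t j) @^-1` B).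
    by rewrite -[_ @^-1` _]setTI; exact: measurable_tnth.
  by apply/funext => t; rewrite /preimage /= /coord mxE.
by move=> _ A mA; rewrite setTI; exact: prefS.
Qed.

HB.instance Definition _ :=
  isMeasurableFun.Build _ _ _ _ row_of_tuple measurable_row_of_tuple.

End measurable_rV.

Section product_probability.
Context d (T : measurableType d) (R : realType).

Definition cons_pair n (p : T * n.-tuple T) : n.+1.-tuple T :=
  [tuple of p.1 :: p.2].

Lemma measurable_cons_pair n : measurable_fun setT (@cons_pair n).
Proof. exact: measurable_cons. Qed.

HB.instance Definition _ n :=
  isMeasurableFun.Build _ _ _ _ (@cons_pair n) (@measurable_cons_pair n).

(* The product measure P 0 \x ... \x P (n - 1) on T^n, i.e. the joint law of
   independent X_0, ..., X_(n-1) with X_i ~ P i; see product_probability_box. *)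
Fixpoint product_probability n :
    ('I_n -> probability T R) -> probability (n.-tuple T) R :=
  match n with
  | 0 => fun _ => \d_([tuple])
  | m.+1 => fun P =>
      distribution (P ord0 \x product_probability (fun i => P (lift ord0 i)))%E
        (@cons_pair m)
  end.

Lemma product_probability_box n (P : 'I_n -> probability T R)
    (A : 'I_n -> set T) : (forall i, measurable (A i)) ->
  product_probability P [set t | forall i, A i (tnth t i)] =
  (\prod_(i < n) P i (A i))%E.
Proof.
elim: n P A => [|n IH] P A mA.
  rewrite big_ord0 /= /dirac indicE mem_set //= => i; by case: i.
rewrite big_ord_recl -IH //=.
set B := [set t : n.-tuple T | forall i, A (lift ord0 i) (tnth t i)].
have mB : measurable B.
  rewrite (_ : B = \bigcap_(i : 'I_n)
      (fun t : n.-tuple T => tnth t i) @^-1` A (lift ord0 i)).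
    apply: fin_bigcap_measurable => // i _.
    by rewrite -[_ @^-1` _]setTI; exact: measurable_tnth.
  by apply/seteqP; split => [t Bt i _|t Bt i]; [exact: Bt|exact: (Bt i Logic.I)].
rewrite -product_measure1E //= /distribution /pushforward; congr (_ _).
apply/seteqP; split => [[x t] /= H|[x t] [/= Ax Bt] i].
  by split => [|i]; [exact: (H ord0)|have := H (lift ord0 i); rewrite tnthS].
by case: (unliftP ord0 i) => [j|] ->; rewrite ?tnthS //; exact: Bt.
Qed.

End product_probability.

Section gaussian_mixture.
Context {R : realType} {d : nat}.

(* The library norm `|x| on 'rV[R]_d is the sup norm. *)
Definition enorm (x : 'rV[R]_d) : R := Num.sqrt (\sum_(j < d) x ord0 j ^+ 2).

Definition gauss_density (z : 'rV[R]_d) : R :=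
  (2 * pi) `^ (- (d%:R / 2)) * expR (- (enorm z ^+ 2 / 2)).

Definition mixture_density (G : {measure set 'rV[R]_d -> \bar R})
    (x : 'rV[R]_d) : R :=
  \int[G]_theta gauss_density (x - theta).

Definition gradient (f : 'rV[R]_d -> R) (x : 'rV[R]_d) : 'rV[R]_d :=
  \row_j 'D_(delta_mx ord0 j) f x.

(* N(m, I_d): independent coordinates, the j-th one being N(m_j, 1). *)
Definition gauss_vector (m : 'rV[R]_d) : probability 'rV[R]_d R :=
  distribution (product_probability (fun j => normal_prob (m ord0 j) 1))
    row_of_tuple.

End gaussian_mixture.

Section compound_decision.
Context {R : realType} {n d : nat}.
Implicit Types theta X : n.-tuple 'rV[R]_d.

Definition empirical_measure theta : {measure set 'rV[R]_d -> \bar R} :=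
  mscale (n%:R^-1)%:nng (msum (fun i => \d_(nth 0 theta i)) n).

Definition oracle_bayes theta (x : 'rV[R]_d) : 'rV[R]_d :=
  let f := mixture_density (empirical_measure theta) in
  x + (f x)^-1 *: gradient f x.

Definition sample_law theta : probability (n.-tuple 'rV[R]_d) R :=
  product_probability (fun i => gauss_vector (tnth theta i)).

Definition risk (T : n.-tuple 'rV[R]_d -> n.-tuple 'rV[R]_d) theta : \bar R :=
  'E_(sample_law theta)[fun X => n%:R^-1 * \sum_(i < n)
     enorm (tnth (T X) i - oracle_bayes theta (tnth X i)) ^+ 2].

Definition minimax_risk (Theta : set (n.-tuple 'rV[R]_d)) : \bar R :=
  ereal_inf [set ereal_sup [set risk T theta | theta in Theta]
            | T in [set T | measurable_fun setT T]].

End compound_decision.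

Definition Theta_class (R : realType) (n d k : nat) : set (n.-tuple 'rV[R]_d) :=
  [set theta | size (undup theta) = k].

Arguments Theta_class : clear implicits.

(* Main.v *)
Require Import Defs.
From mathcomp Require Import all_boot all_order all_algebra.
From mathcomp Require Import all_classical all_reals all_analysis.
From mathcomp Require Import measurable_realfun ring lra.

(** Estimating the oracle is at least as hard as estimating well-separated means.

    For [k >= 2] distinct values, put [k - 1] of the parameters at isolated places of
    the first coordinate axis, at distance of order [n] from each other and from a
    common site that holds all the remaining parameters. Each isolated parameter is
    shifted by 1 or not, according to a free bit. The oracle at [X_i] is the posterior
    mean given [X_i] under the uniform law on the true parameters ([oracle_bayesE]).
    If [X_i] is within 1 of an isolated [theta_i], the other parameters have
    negligible weight and the oracle is within [1/4] of [theta_i] ([oracle_close]).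
    Hence whoever estimates the oracle decides the bit. But only [X_i] carries
    information on that bit, and two unit Gaussians at distance 1 are not separable:
    each isolated index costs a constant ([two_point_bound]), and averaging over all
    the bits ([hypercube_bound]) gives a risk of order [(k - 1) / n >= k / (2 n)]
    ([minimax_risk_spread]).

    For [k = 1] there is no isolated parameter. The oracle is then the common value
    itself, and it cannot be located from [n] observations with squared error below
    the order of [1 / n] ([minimax_risk_one_cluster]).

    Both cases rest on the explicit likelihood ratio of two Gaussian samples with
    different means ([has_density_sample_law]). *)

Set Implicit Arguments.
Unset Strict Implicit.
Unset Printing Implicit Defensive.

Import Order.TTheory GRing.Theory Num.Theory.
Import numFieldNormedType.Exports.

Local Open Scope classical_set_scope.
Local Open Scope ring_scope.

(** * Measures given by a density *)

Section density.
Context {d} {T : measurableType d} {R : realType}.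
Local Open Scope ereal_scope.
Import HBNNSimple.

(** Stated through integrals of nonnegative functions, so that densities compose
    and multiply by plain rewriting: no Radon-Nikodym derivative, hence no
    almost-everywhere equality, is involved. *)
Definition has_density (P Q : {measure set T -> \bar R}) (L : T -> R) :=
  [/\ measurable_fun [set: T] L, forall x, (0 <= L x)%R &
     forall f : T -> \bar R, measurable_fun [set: T] f -> (forall x, 0 <= f x) ->
       \int[Q]_x f x = \int[P]_x (f x * (L x)%:E)].

(** The passage from sets to functions: both sides are linear on simple functions
    and continuous along the increasing approximation of [f] by them. *)
Lemma has_density_set (P Q : {measure set T -> \bar R}) (L : T -> R) :
  measurable_fun setT L -> (forall x, (0 <= L x)%R) ->
  (forall A, measurable A -> Q A = \int[P]_(x in A) (L x)%:E) ->
  has_density P Q L.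
Proof.
move=> mL L0 QL; split => // f mf f0.
have nnsfunE (h : {nnsfun T >-> R}) :
    \int[Q]_x (h x)%:E = \int[P]_x ((h x)%:E * (L x)%:E).
  under eq_integral do rewrite fimfunE -fsumEFin//.
  rewrite ge0_integral_fsum//; last 2 first.
  - move=> r; apply/measurable_EFinP; apply: measurable_funM => //.
  - by move=> r x _; exact: nnfun_muleindic_ge0.
  under [RHS]eq_integral => x _.
    rewrite fimfunE -fsumEFin// ge0_mule_fsuml; last first.
      by move=> r; exact: nnfun_muleindic_ge0.
    over.
  rewrite ge0_integral_fsum//; last 2 first.
  - move=> r; apply: emeasurable_funM; apply/measurable_EFinP => //.
    by apply: measurable_funM.
  - by move=> r x _; rewrite mule_ge0 ?lee_fin//; exact: nnfun_muleindic_ge0.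
  apply: eq_fsbigr => r _.
  have mA : measurable (h @^-1` [set r]) by [].
  rewrite integralZl_indic_nnsfun// integral_indic// setIT QL//.
  have [r0|r0] := ltP r 0%R.
    rewrite preimage_nnfun0// integral_set0 mule0 integral0_eq// => x _.
    by rewrite indicE in_set0 mulr0 mul0e.
  under [RHS]eq_integral do rewrite EFinM -muleA.
  rewrite ge0_integralZl//.
  - congr (_ * _); rewrite integral_mkcond; apply: eq_integral => x _.
    by rewrite /patch indicE; case: ifP => _; rewrite ?mul1e ?mul0e.
  - apply: emeasurable_funM; apply/measurable_EFinP => //.
  - by move=> x _; rewrite mule_ge0 ?lee_fin.
pose h := nnsfun_approx measurableT mf.
have cvgh x : EFin \o h ^~ x @ \oo --> f x.
  by apply: cvg_nnsfun_approx.
transitivity (limn (fun n => \int[Q]_x (h n x)%:E)).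
  rewrite -monotone_convergence//.
  - by apply: eq_integral => x _; apply/esym/cvg_lim => //; exact: cvgh.
  - by move=> n; exact/measurable_EFinP.
  - by move=> n x _; rewrite lee_fin.
  - by move=> x _ a b ab; rewrite lee_fin; exact/lefP/nd_nnsfun_approx.
under eq_fun do rewrite nnsfunE.
rewrite -monotone_convergence//.
- apply: eq_integral => x _; apply/cvg_lim => //.
  by apply: cvgeZr => //; exact: cvgh.
- move=> n; apply: emeasurable_funM; exact/measurable_EFinP.
- by move=> n x _; rewrite mule_ge0 ?lee_fin.
- by move=> x _ a b ab; rewrite lee_wpmul2r ?lee_fin//; exact/lefP/nd_nnsfun_approx.
Qed.

(** Markov's inequality: a density integrates to 1, so it exceeds 2 with
    probability at most one half. *)
Lemma density_le2_prob (P Q : probability T R) L :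
  has_density P Q L -> (1 / 2)%:E <= P [set x | (L x <= 2)%R].
Proof.
move=> [mL L0 QL].
pose A : set T := [set x | (L x <= 2)%R].
have mA : measurable A.
  have := mL measurableT `]-oo, 2%R]%classic (measurable_itv _).
  by rewrite setTI; congr measurable; apply/seteqP; split => x /=; rewrite in_itv.
have mAC : measurable (~` A) by exact: measurableC.
have L1 : \int[P]_x (L x)%:E = 1.
  have mc : measurable_fun [set: T] (cst 1 : T -> \bar R) by exact: measurable_cst.
  have := QL _ mc (fun=> lee01).
  rewrite integral_cst//= probability_setT mul1e => ->.
  by apply: eq_integral => x _; rewrite mul1e.
have PAC : 2%:E * P (~` A) <= 1.
  rewrite -L1 -(setIT (~` A)) -integral_indic// -ge0_integralZl_EFin//; last first.
    by apply/measurable_EFinP; exact: measurable_indic.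
  apply: ge0_le_integral => //.
  - by apply: emeasurable_funM => //; apply/measurable_EFinP; exact: measurable_indic.
  - exact/measurable_EFinP.
  move=> x _; rewrite -EFinM lee_fin indicE.
  have [|_] := boolP (x \in ~` A); last by rewrite mulr0.
  by rewrite inE => /negP; rewrite -ltNge mulr1 => /ltW.
rewrite -/A; move: PAC; rewrite probability_setC//.
rewrite -(fineK (fin_num_measure P A mA)); move: (fine _) => r.
by rewrite -EFinB -EFinM !lee_fin => ?; lra.
Qed.

End density.

(** * Two hypotheses that cannot be told apart *)

Section two_points.
Context {d} {T : measurableType d} {R : realType}.
Local Open Scope ereal_scope.

(** Le Cam's two-point argument. Seen from [P], the second loss carries the weight
    [L >= c], so on [A] the two losses add up to at least
    [c * ((g - t) ^ 2 + (g - t') ^ 2)], which the parallelogram identity bounds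
    below by [c * (t - t') ^ 2 / 2] whatever [g] is. The targets [t] and [t'] may
    depend on the observation, as the oracle does. *)
Lemma two_point_bound (P Q : {measure set T -> \bar R}) (L g t t' : T -> R)
    (A : set T) (c delta : R) :
  has_density P Q L ->
  measurable_fun [set: T] g -> measurable_fun [set: T] t ->
  measurable_fun [set: T] t' -> measurable A -> (0 <= c <= 1)%R -> (0 <= delta)%R ->
  (forall x, A x -> (c <= L x)%R) ->
  (forall x, A x -> (delta <= `|t x - t' x|)%R) ->
  (c * delta ^+ 2 / 2)%:E * P A <=
  \int[P]_x ((g x - t x) ^+ 2)%:E + \int[Q]_x ((g x - t' x) ^+ 2)%:E.
Proof.
move=> [mL L0 QL] mg mt mt' mA /andP[c0 c1] delta0 Lc tA.
have msq (u : T -> R) : measurable_fun [set: T] u ->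
    measurable_fun [set: T] (fun x => ((g x - u x) ^+ 2)%:E).
  by move=> mu; apply/measurable_EFinP; apply: measurable_funX; exact: measurable_funB.
rewrite QL; [|exact: msq|by move=> x; rewrite lee_fin sqr_ge0].
have mgL : measurable_fun [set: T] (fun x => ((g x - t' x) ^+ 2)%:E * (L x)%:E).
  by apply: emeasurable_funM; [exact: msq|exact/measurable_EFinP].
have L1 x : 0 <= ((g x - t' x) ^+ 2)%:E * (L x)%:E.
  by rewrite mule_ge0 ?lee_fin ?sqr_ge0.
rewrite -ge0_integralD; [|by []|by move=> x _; rewrite lee_fin sqr_ge0|exact: msq|by []|exact: mgL].
have cd0 : (0 <= c * delta ^+ 2 / 2)%R.
  by rewrite divr_ge0// mulr_ge0// sqr_ge0.
rewrite -(setIT A) -integral_indic// -ge0_integralZl_EFin//; last first.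
  by apply/measurable_EFinP; exact: measurable_indic.
apply: ge0_le_integral => //.
- by move=> x _; rewrite mule_ge0// lee_fin.
- apply: emeasurable_funM => //.
  by apply/measurable_EFinP; exact: measurable_indic.
- by apply: emeasurable_funD => //; exact: msq.
move=> x _; rewrite -!EFinM -EFinD lee_fin indicE.
have [Ax|Ax] := boolP (x \in A); last first.
  by rewrite mulr0 addr_ge0 ?sqr_ge0// mulr_ge0 ?sqr_ge0.
rewrite mulr1; rewrite inE in Ax.
have h1 := Lc _ Ax; have h2 := tA _ Ax.
have h3 : (delta ^+ 2 <= (t x - t' x) ^+ 2)%R.
  by rewrite -[leRHS]real_normK ?num_real// lerXn2r ?nnegrE.
have h4 : (c * (g x - t' x) ^+ 2 <= (g x - t' x) ^+ 2 * L x)%R.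
  by rewrite mulrC ler_wpM2l// sqr_ge0.
have h5 : (c * (g x - t x) ^+ 2 <= (g x - t x) ^+ 2)%R.
  by rewrite -[leRHS]mul1r ler_wpM2r// sqr_ge0.
apply: le_trans (lerD h5 h4); rewrite -mulrDr -mulrA ler_wpM2l//.
have := sqr_ge0 ((g x - t x) + (g x - t' x))%R.
move: h3; rewrite !expr2; lra.
Qed.

End two_points.

(** * Likelihood ratios of Gaussian samples *)

Section normal.
Context {R : realType}.
Local Notation mu := (@lebesgue_measure R).

Lemma lebesgue_density_normal_prob (m s : R) :
  has_density mu (normal_prob m s) (normal_pdf m s).
Proof.
apply: has_density_set => // [|x]; first exact: measurable_normal_pdf.
exact: normal_pdf_ge0.
Qed.

Lemma has_density_normal_prob (m m' : R) :
  has_density (normal_prob m 1) (normal_prob m' 1)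
    (fun x : R => expR ((m' - m) * (x - m) - (m' - m) ^+ 2 / 2)).
Proof.
have mL : measurable_fun setT
  (fun x : R => expR ((m' - m) * (x - m) - (m' - m) ^+ 2 / 2)).
  apply: measurableT_comp => //; apply: measurable_funB => //.
  by apply: measurable_funM => //; exact: measurable_funB.
split; [exact: mL|by move=> x; exact: expR_ge0|move=> f mf f0].
have [_ _ /(_ _ mf f0)->] := lebesgue_density_normal_prob m' 1.
have mfL : measurable_fun [set: R]
    (fun x => f x * (expR ((m' - m) * (x - m) - (m' - m) ^+ 2 / 2))%:E)%E.
  by apply: emeasurable_funM; [exact: mf|exact/measurable_EFinP].
have fL0 x : (0 <= f x * (expR ((m' - m) * (x - m) - (m' - m) ^+ 2 / 2))%:E)%E.
  by rewrite mule_ge0// lee_fin expR_ge0.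
have [_ _ /(_ _ mfL fL0) PE] := lebesgue_density_normal_prob m 1.
apply: etrans _ (esym PE); apply: eq_integral => x _; rewrite -muleA -EFinM; congr (_ * _%:E)%E.
rewrite !normal_pdfE ?oner_neq0//= mulrCA -expRD; congr (_ * expR _).
by rewrite expr1n; field.
Qed.

End normal.

Section product.
Context d (T : measurableType d) (R : realType).

(** Densities multiply along independent coordinates, by Tonelli. *)
Lemma has_density_product_probability n (P Q : 'I_n -> probability T R)
    (L : 'I_n -> T -> R) : (forall i, has_density (P i) (Q i) (L i)) ->
  has_density (product_probability P) (product_probability Q)
    (fun t => \prod_(i < n) L i (tnth t i)).
Proof.
elim: n P Q L => [|n IH] P Q L PQ.
  split => [|x|f mf f0].
  - by under eq_fun do rewrite big_ord0; exact: measurable_cst.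
  - by rewrite big_ord0.
  - by apply: eq_integral => x _; rewrite big_ord0 mule1.
have mL : measurable_fun setT (fun t : n.+1.-tuple T => \prod_(i < n.+1) L i (tnth t i)).
  apply: measurable_prod => i _; have [mL _ _] := PQ i.
  by apply: measurableT_comp => //; exact: measurable_tnth.
have L0 t : 0 <= \prod_(i < n.+1) L i (tnth t i).
  by apply: prodr_ge0 => i _; have [_ L0 _] := PQ i.
split => // f mf f0 /=.
have [mL0 L00 QL0] := PQ ord0.
have [mL' L'0 QL'] := IH (fun i => P (lift ord0 i)) _ _ (fun i => PQ (lift ord0 i)).
have mfc : measurable_fun setT (f \o @cons_pair _ T n).
  exact: measurableT_comp.
have mfL : measurable_fun setT (fun t : n.+1.-tuple T => f t * (\prod_(i < n.+1) L i (tnth t i))%:E)%E.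
  by apply: emeasurable_funM => //; exact/measurable_EFinP.
have mfLc : measurable_fun setT ((fun t => f t * (\prod_(i < n.+1) L i (tnth t i))%:E)%E \o @cons_pair _ T n).
  exact: measurableT_comp.
rewrite !ge0_integral_distribution//; last first.
  by move=> t; rewrite mule_ge0 ?lee_fin.
rewrite fubini_tonelli1//; last by move=> x /=.
rewrite fubini_tonelli1//; last by move=> x /=; rewrite mule_ge0 ?lee_fin.
have mfx x : measurable_fun [set: n.-tuple T] (fun y => f (@cons_pair _ T n (x, y))).
  by apply: (measurableT_comp mfc); exact: pair1_measurable.
have mF : measurable_fun [set: T] (fubini_F
    (product_probability (fun i => Q (lift ord0 i))) (f \o @cons_pair _ T n)).
  by apply: measurable_fun_fubini_tonelli_F => [|x]; [exact: mfc|exact: f0].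
rewrite /fubini_F QL0; [|exact: mF|by move=> x; apply: integral_ge0 => y _; exact: f0].
apply: eq_integral => x _.
rewrite QL'; [|exact: mfx|by move=> y; exact: f0].
have mfxL : measurable_fun [set: n.-tuple T] (fun y => f (cons_pair (x, y)) *
    (\prod_(i < n) L (lift ord0 i) (tnth y i))%:E)%E.
  by apply: emeasurable_funM; [exact: mfx|exact/measurable_EFinP].
rewrite -ge0_integralZr; [|by []|exact: mfxL| |by rewrite lee_fin]; last first.
  by move=> y _; rewrite mule_ge0 ?lee_fin//; exact: f0.
apply: eq_integral => y _ /=; rewrite big_ord_recl -muleA -EFinM mulrC.
by congr (_ * (_ * _)%:E)%E; apply: eq_bigr => i _; rewrite tnthS.
Qed.

End product.

Section gaussian_samples.
Context {R : realType}.

Lemma product_probability_coord d (T : measurableType d) n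
    (P : 'I_n -> probability T R) (i : 'I_n) (A : set T) : measurable A ->
  product_probability P [set t | A (tnth t i)] = P i A.
Proof.
move=> mA; pose B j := if j == i then A else setT.
have -> : [set t : n.-tuple T | A (tnth t i)] = [set t | forall j, B j (tnth t j)].
  apply/seteqP; split => [t At j|t /(_ i)]; rewrite /B /=; last by rewrite eqxx.
  by case: eqP => [->|].
rewrite product_probability_box; last first.
  by move=> j; rewrite /B; case: ifP.
rewrite (bigD1 i)//= {1}/B eqxx big1 ?mule1// => j ji.
by rewrite /B (negbTE ji) probability_setT.
Qed.

Definition gauss_ratio {d} (m m' x : 'rV[R]_d) : R :=
  \prod_(j < d) expR ((m' ord0 j - m ord0 j) * (x ord0 j - m ord0 j) -
                      (m' ord0 j - m ord0 j) ^+ 2 / 2).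

Lemma ge0_integral_gauss_vector d (m : 'rV[R]_d) (f : 'rV[R]_d -> \bar R) :
  measurable_fun [set: 'rV[R]_d] f -> (forall x, 0 <= f x)%E ->
  (\int[gauss_vector m]_x f x =
   \int[product_probability (fun j => normal_prob (m ord0 j) 1)]_t f (row_of_tuple t))%E.
Proof. by move=> mf f0; exact: ge0_integral_distribution. Qed.

Lemma has_density_gauss_vector d (m m' : 'rV[R]_d) :
  has_density (gauss_vector m) (gauss_vector m') (gauss_ratio m m').
Proof.
have mgr : measurable_fun [set: 'rV[R]_d] (gauss_ratio m m').
  apply: measurable_prod => j _; apply: measurableT_comp => //.
  apply: measurable_funB => //; apply: measurable_funM => //.
  by apply: measurable_funB => //; exact: measurable_rV_coord.
have gr0 x : 0 <= gauss_ratio m m' x.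
  by apply: prodr_ge0 => j _; exact: expR_ge0.
split; [exact: mgr|exact: gr0|move=> f mf f0].
have mfr : measurable_fun [set: 'rV[R]_d]
    (fun x => f x * (gauss_ratio m m' x)%:E)%E.
  by apply: emeasurable_funM; [exact: mf|exact/measurable_EFinP].
have fr0 x : (0 <= f x * (gauss_ratio m m' x)%:E)%E by rewrite mule_ge0// lee_fin.
apply: etrans (ge0_integral_gauss_vector m' mf f0) _.
apply: etrans _ (esym (ge0_integral_gauss_vector m mfr fr0)).
have [_ _ QL] := has_density_product_probability
  (fun j => has_density_normal_prob (m ord0 j) (m' ord0 j)).
have mft : measurable_fun [set: d.-tuple (measurableTypeR R)] (f \o row_of_tuple).
  exact: measurableT_comp.
apply: etrans (QL _ mft (fun t => f0 _)) _.
apply: eq_integral => x _ /=; congr (_ * _%:E)%E.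
by apply: eq_bigr => j _; rewrite mxE.
Qed.

Definition sample_ratio {n d} (theta theta' X : n.-tuple 'rV[R]_d) : R :=
  \prod_(i < n) gauss_ratio (tnth theta i) (tnth theta' i) (tnth X i).

Lemma has_density_sample_law n d (theta theta' : n.-tuple 'rV[R]_d) :
  has_density (sample_law theta) (sample_law theta') (sample_ratio theta theta').
Proof.
exact: (has_density_product_probability
  (fun i => has_density_gauss_vector (tnth theta i) (tnth theta' i))).
Qed.

Lemma sample_law_coord n d (theta : n.-tuple 'rV[R]_d) i j (A : set R) :
  measurable A ->
  sample_law theta [set X : n.-tuple 'rV[R]_d | A (tnth X i ord0 j)] =
  normal_prob (tnth theta i ord0 j) 1 A.
Proof.
move=> mA.
have mAj : measurable [set x : 'rV[R]_d | A (x ord0 j)].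
  by have := measurable_rV_coord j measurableT mA; rewrite setTI.
rewrite /sample_law (product_probability_coord _ i mAj).
rewrite -(product_probability_coord (fun j => normal_prob (tnth theta i ord0 j) 1) j mA).
transitivity (product_probability (fun j => normal_prob (tnth theta i ord0 j) 1)
  (row_of_tuple @^-1` [set x : 'rV[R]_d | A (x ord0 j)])); first by [].
by congr (product_probability _ _); apply/seteqP; split => t /=; rewrite mxE.
Qed.

(** On this interval the density is at least its value at [m + 1]. *)
Lemma normal_prob_itv_ge (m : R) :
  ((normal_peak 1 * expR (- 1 / 2))%:E <= normal_prob m 1 `[m, (m + 1)%R]%classic)%E.
Proof.
rewrite /normal_prob.
apply: (@le_trans _ _ (\int[lebesgue_measure]_(x in `[m, (m + 1)%R]%classic)
   (normal_peak 1 * expR (- 1 / 2))%:E)%E).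
  rewrite integral_cst//= lebesgue_measure_itv/= lte_fin ltrDl ltr01.
  by rewrite -EFinB addrAC subrr add0r mule1.
apply: ge0_le_integral => //=.
- by move=> x _; rewrite lee_fin mulr_ge0 ?normal_peak_ge0 ?expR_ge0.
- by apply/measurable_funTS/measurable_EFinP; exact: measurable_normal_pdf.
move=> x; rewrite in_itv/= => /andP[mx xm].
rewrite lee_fin normal_pdfE ?oner_neq0// ler_wpM2l ?normal_peak_ge0//.
rewrite /normal_fun ler_expR expr1n.
have : (x - m) ^+ 2 <= 1 by rewrite expr_le1//; lra.
lra.
Qed.

End gaussian_samples.

(** * The oracle is the posterior mean *)

Section oracle.
Context {R : realType} {d : nat}.

Lemma sqr_enorm (x : 'rV[R]_d) : enorm x ^+ 2 = \sum_(j < d) x ord0 j ^+ 2.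
Proof. by rewrite sqr_sqrtr// sumr_ge0// => j _; exact: sqr_ge0. Qed.

Lemma gauss_density_gt0 (z : 'rV[R]_d) : 0 < gauss_density z.
Proof. by rewrite mulr_gt0 ?expR_gt0// powR_gt0// mulr_gt0 ?pi_gt0. Qed.

Lemma measurable_gauss_density d' (T : measurableType d') (u : T -> 'rV[R]_d) :
  (forall j, measurable_fun [set: T] (fun t => u t ord0 j)) ->
  measurable_fun [set: T] (fun t => gauss_density (u t)).
Proof.
move=> mu; rewrite /gauss_density.
apply: measurable_funM => //; apply: measurableT_comp => //.
under eq_fun do rewrite sqr_enorm.
apply: measurableT_comp => //; apply: measurable_funM => //.
by apply: measurable_sum => j; exact: measurable_funX.
Qed.

Lemma mixture_density_empirical n (theta : n.-tuple 'rV[R]_d) x :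
  mixture_density (empirical_measure theta) x =
  n%:R^-1 * \sum_(i < n) gauss_density (x - tnth theta i).
Proof.
have mg : measurable_fun [set: 'rV[R]_d] (fun t => (gauss_density (x - t))%:E).
  apply/measurable_EFinP/measurable_gauss_density => j.
  under eq_fun do rewrite !mxE.
  by apply: measurable_funB => //; exact: measurable_rV_coord.
have g0 t : (0 <= (gauss_density (x - t))%:E)%E by rewrite lee_fin ltW// gauss_density_gt0.
rewrite /mixture_density /Rintegral ge0_integral_mscale// ge0_integral_measure_sum//.
under eq_bigr => i _.
  rewrite integral_dirac// diracT mul1e.
  over.
rewrite sumEFin -EFinM /=; congr (_ * _).
by apply: eq_bigr => i _; rewrite (tnth_nth 0).
Qed.

Lemma derive_line (V : normedModType R) (f : V -> R) (a v : V) :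
  'D_v f a = 'D_1 (fun h : R => f (h *: v + a)) 0.
Proof.
rewrite /derive.
set F := (fun h : R => _ *: _); set G := (fun h : R => _ *: _ in RHS).
suff -> : F = G by [].
apply/funext => h; rewrite /F /G /=.
by rewrite addr0 scale0r add0r [h *: 1]mulr1.
Qed.

(** Along the line through [x] in direction [j], each Gaussian density is its value
    at [x] times [expR (h * b - h ^ 2 / 2)], with [b] the [j]-th coordinate of
    [theta_i - x]; its derivative at [h = 0] is therefore [b] times that value. *)
Lemma derive_gauss_mixture n (c : R) (theta : n.-tuple 'rV[R]_d) x j :
  'D_(delta_mx ord0 j) (fun x => c * \sum_(i < n) gauss_density (x - tnth theta i)) x =
  c * \sum_(i < n) gauss_density (x - tnth theta i) * (tnth theta i ord0 j - x ord0 j).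
Proof.
rewrite derive_line.
have lineE i h : gauss_density (h *: delta_mx ord0 j + x - tnth theta i) =
    gauss_density (x - tnth theta i) *
    expR (h * (tnth theta i ord0 j - x ord0 j) - h ^+ 2 / 2).
  rewrite /gauss_density -mulrA -expRD; congr (_ * expR _).
  rewrite !sqr_enorm (bigD1 j)//= [in RHS](bigD1 j)//= !mxE !eqxx mulr1.
  rewrite [X in _ + X](eq_bigr (fun k => (x - tnth theta i) ord0 k ^+ 2)); last first.
    by move=> k kj; rewrite !mxE (negbTE kj) andbF mulr0 add0r.
  by field.
pose b i := tnth theta i ord0 j - x ord0 j.
pose e i (h : R) := gauss_density (x - tnth theta i) * expR (h * b i - h ^+ 2 / 2).
have -> : (fun h : R => c * \sum_(i < n)
    gauss_density (h *: delta_mx ord0 j + x - tnth theta i)) = c *: (\sum_(i < n) e i).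
  apply/funext => h; rewrite fctE fct_sumE; congr (_ * _).
  by apply: eq_bigr => i _; rewrite lineE.
have de i : is_derive (0 : R) 1 (e i) (gauss_density (x - tnth theta i) * b i).
  have dq : is_derive (0 : R) 1 (fun h : R => h * b i - h ^+ 2 / 2) (b i).
    apply: is_derive_eq.
    by rewrite /GRing.scale/=; field.
  apply: is_derive_eq.
  rewrite /GRing.scale/= !mul0r expr0n/= ?mul0r ?subrr ?oppr0 ?addr0 ?expR0.
  by rewrite mul1r.
have dS : is_derive (0 : R) 1 (c *: (\sum_(i < n) e i))
    (c *: (\sum_(i < n) gauss_density (x - tnth theta i) * b i)).
  by apply: is_deriveZ; apply: is_derive_sum.
exact: (@derive_val _ _ _ _ _ _ _ dS).
Qed.

Lemma sum_gauss_density_gt0 n (theta : n.-tuple 'rV[R]_d) (x : 'rV[R]_d) : (0 < n)%N ->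
  0 < \sum_(i < n) gauss_density (x - tnth theta i).
Proof.
move=> n0; rewrite (bigD1 (Ordinal n0))//= ltr_wpDr ?gauss_density_gt0//.
by apply: sumr_ge0 => i _; exact/ltW/gauss_density_gt0.
Qed.

(** Tweedie's formula: [x] plus the gradient of the log of the mixture density is
    the mean of the [theta_i] under weights proportional to their likelihoods. *)
Lemma oracle_bayesE n (theta : n.-tuple 'rV[R]_d) x j : (0 < n)%N ->
  oracle_bayes theta x ord0 j =
  (\sum_(i < n) gauss_density (x - tnth theta i) * tnth theta i ord0 j) /
  \sum_(i < n) gauss_density (x - tnth theta i).
Proof.
move=> n0.
have n1 : n%:R != 0 :> R by rewrite pnatr_eq0 -lt0n.
set S := \sum_(i < n) gauss_density (x - tnth theta i).
have S0 : 0 < S by exact: sum_gauss_density_gt0.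
rewrite /oracle_bayes !mxE.
have -> : mixture_density (empirical_measure theta) =
    (fun x => n%:R^-1 * \sum_(i < n) gauss_density (x - tnth theta i)).
  by apply/funext => y; rewrite mixture_density_empirical.
rewrite derive_gauss_mixture -/S.
under eq_bigr do rewrite mulrBr.
rewrite sumrB -mulr_suml -/S.
by field; rewrite n1 gt_eqF.
Qed.

Lemma measurable_oracle_bayes n d' (T : measurableType d')
    (theta : n.-tuple 'rV[R]_d) (u : T -> 'rV[R]_d) j : (0 < n)%N ->
  (forall j, measurable_fun [set: T] (fun t => u t ord0 j)) ->
  measurable_fun [set: T] (fun t => oracle_bayes theta (u t) ord0 j).
Proof.
move=> n0 mu; under eq_fun do rewrite oracle_bayesE//.
have mg i : measurable_fun [set: T] (fun t => gauss_density (u t - tnth theta i)).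
  apply: measurable_gauss_density => k.
  by under eq_fun do rewrite !mxE; exact: measurable_funB.
apply: measurable_funM.
  by apply: measurable_sum => i; exact: measurable_funM.
have S0 t : 0 <= \sum_(i < n) gauss_density (u t - tnth theta i).
  exact/ltW/sum_gauss_density_gt0.
(* On nonnegative reals the inverse is the power of exponent -1, a measurable map. *)
under eq_fun do rewrite -(powR_inv1 (S0 _)).
apply: (measurableT_comp (measurable_powR _)).
by apply: measurable_sum.
Qed.

End oracle.

(** * Averaging the risk over a hypercube of parameters *)

Section hypercube.
Context {R : realType} {n d : nat}.

Definition coord_loss (g : n.-tuple 'rV[R]_d -> R) (theta : n.-tuple 'rV[R]_d)
    (i : 'I_n) (j : 'I_d) : \bar R :=
  \int[sample_law theta]_X
    ((g X - oracle_bayes theta (tnth X i) ord0 j) ^+ 2)%:E.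

Lemma measurable_sample_coord (i : 'I_n) (j : 'I_d) :
  measurable_fun [set: n.-tuple 'rV[R]_d] (fun X => tnth X i ord0 j).
Proof.
by apply: (measurableT_comp (measurable_rV_coord j)); exact: measurable_tnth.
Qed.

Lemma measurable_oracle_coord (theta : n.-tuple 'rV[R]_d) (i : 'I_n) (j : 'I_d) :
  measurable_fun [set: n.-tuple 'rV[R]_d]
    (fun X => oracle_bayes theta (tnth X i) ord0 j).
Proof.
apply: measurable_oracle_bayes => [|k]; last exact: measurable_sample_coord.
by case: i; case: n.
Qed.

(** Only coordinate [j] of each error is kept: the parameters used below vary along a
    single axis, so the dimension does not enter the lower bound. *)
Lemma risk_ge_coord_loss (T : n.-tuple 'rV[R]_d -> n.-tuple 'rV[R]_d) theta j :
  measurable_fun [set: n.-tuple 'rV[R]_d] T ->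
  ((n%:R^-1)%:E * \sum_(i < n) coord_loss (fun X => tnth (T X) i ord0 j) theta i j
    <= risk T theta)%E.
Proof.
move=> mT.
have mTc i k : measurable_fun [set: n.-tuple 'rV[R]_d] (fun X => tnth (T X) i ord0 k).
  exact: (measurableT_comp (measurable_sample_coord i k) mT).
have mdiff i k : measurable_fun [set: n.-tuple 'rV[R]_d]
    (fun X => (tnth (T X) i ord0 k - oracle_bayes theta (tnth X i) ord0 k) ^+ 2).
  by apply: measurable_funX; apply: measurable_funB; [exact: mTc|exact: measurable_oracle_coord].
have subE (u v : 'rV[R]_d) k : (u - v) ord0 k = u ord0 k - v ord0 k.
  by rewrite !mxE.
rewrite /risk expectation.unlock /coord_loss.
rewrite -ge0_integral_sum; last 3 first.
- by [].
- by move=> i; apply/measurable_EFinP; exact: mdiff.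
- by move=> i X _; rewrite lee_fin sqr_ge0.
rewrite -ge0_integralZl_EFin; last 4 first.
- by [].
- by move=> X _; apply: sume_ge0 => i _; rewrite lee_fin sqr_ge0.
- by apply: emeasurable_sum => i; apply/measurable_EFinP; exact: mdiff.
- by rewrite invr_ge0 ler0n.
apply: ge0_le_integral.
- by [].
- move=> X _; rewrite mule_ge0 ?lee_fin ?invr_ge0//.
  by apply: sume_ge0 => i _; rewrite lee_fin sqr_ge0.
- apply: emeasurable_funM => //.
  by apply: emeasurable_sum => i; apply/measurable_EFinP; exact: mdiff.
- apply/measurable_EFinP; apply: measurable_funM => //.
  apply: measurable_sum => i; under eq_fun do rewrite sqr_enorm.
  apply: measurable_sum => k; under eq_fun do rewrite subE.
  exact: mdiff.
move=> X _; rewrite sumEFin -EFinM lee_fin ler_wpM2l ?invr_ge0//.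
apply: ler_sum => i _; rewrite sqr_enorm (bigD1 j)//= subE lerDl.
by apply: sumr_ge0 => k _; exact: sqr_ge0.
Qed.

Definition flip {J : finType} (k : J) (e : {ffun J -> bool}) : {ffun J -> bool} :=
  [ffun l => if l == k then ~~ e l else e l].

Lemma flipK {J : finType} (k : J) : involutive (flip k).
Proof. by move=> e; apply/ffunP => l; rewrite !ffunE; case: eqP => // _; rewrite negbK. Qed.

(** Assouad's lemma. The supremum of the risk over [Theta] dominates its average over
    the hypercube of bits. For each index [i] in [S], the average of its loss is half
    the average over [e] of the losses at [e] and at [e] with the bit [b i] flipped,
    and each such pair contributes at least [c]. *)
Lemma hypercube_bound (J : finType) (theta : {ffun J -> bool} -> n.-tuple 'rV[R]_d)
    (Theta : set (n.-tuple 'rV[R]_d)) (S : {set 'I_n}) (b : 'I_n -> J)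
    (j : 'I_d) (c : R) :
  (0 < n)%N ->
  (forall e, Theta (theta e)) ->
  (forall g i (e : {ffun J -> bool}), measurable_fun [set: n.-tuple 'rV[R]_d] g -> i \in S ->
     e (b i) = false ->
     (c%:E <= coord_loss g (theta e) i j + coord_loss g (theta (flip (b i) e)) i j)%E) ->
  ((c * #|S|%:R / (2 * n%:R))%:E <= minimax_risk Theta)%E.
Proof.
move=> n0 Theta_theta pair_bound.
apply: le_ereal_inf_tmp => _ [T /= mT <-].
set M := ereal_sup _.
have risk_le e : (risk T (theta e) <= M)%E.
  by apply: ereal_sup_ubound; exists (theta e).
pose h i e := coord_loss (fun X => tnth (T X) i ord0 j) (theta e) i j.
have h0 i e : (0 <= h i e)%E.
  by apply: integral_ge0 => X _; rewrite lee_fin sqr_ge0.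
have mTc i : measurable_fun [set: n.-tuple 'rV[R]_d] (fun X => tnth (T X) i ord0 j).
  exact: (measurableT_comp (measurable_sample_coord i j) mT).
have hpair i e : i \in S -> (c%:E <= h i e + h i (flip (b i) e))%E.
  move=> iS; case ebi : (e (b i)); last exact: pair_bound.
  rewrite addeC -{2}(flipK (b i) e); apply: pair_bound => //.
  by rewrite ffunE eqxx ebi.
pose N := #|{ffun J -> bool}|.
have N0 : 0 < N%:R :> R by rewrite ltr0n /N card_ffun card_bool expn_gt0.
have hsum i : i \in S -> ((N%:R * c / 2)%:E <= \sum_e h i e)%E.
  move=> iS; suff : ((N%:R * c)%:E <= \sum_e h i e + \sum_e h i e)%E.
    case: (\sum_e h i e)%E => [r| |]; [|by move=> _; exact: leey|by []].
    by rewrite -EFinD !lee_fin => ?; lra.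
  rewrite {2}(reindex_inj (inv_inj (flipK (b i)))) -big_split/=.
  rewrite -[leLHS](_ : (\sum_(e : {ffun J -> bool}) c%:E)%E = _).
    by apply: lee_sum => e _; exact: hpair.
  by rewrite sumEFin sumr_const mulr_natl.
have : ((N%:R * (c * #|S|%:R / (2 * n%:R)))%:E <= N%:R%:E * M)%E.
  apply: (@le_trans _ _ (\sum_e risk T (theta e))%E); last first.
    apply: (@le_trans _ _ (\sum_(e : {ffun J -> bool}) M)%E).
      by apply: lee_sum => e _.
    by rewrite sumr_const mule_natl.
  apply: (@le_trans _ _ (\sum_e (n%:R^-1)%:E * \sum_(i < n) h i e)%E); last first.
    by apply: lee_sum => e _; exact: risk_ge_coord_loss.
  rewrite -ge0_sume_distrr; last by move=> e _; apply: sume_ge0.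
  rewrite exchange_big/=.
  apply: (@le_trans _ _ ((n%:R^-1)%:E * \sum_(i in S) (N%:R * c / 2)%:E)%E).
    rewrite sumEFin sumr_const -EFinM lee_fin -mulr_natl.
    by rewrite le_eqVlt; apply/orP; left; apply/eqP; field; rewrite pnatr_eq0 -lt0n.
  rewrite lee_wpmul2l ?lee_fin ?invr_ge0//.
  rewrite [leRHS](bigID (fun i => i \in S))/=.
  rewrite -[leLHS]adde0 leeD//; last by apply: sume_ge0 => i _; exact: sume_ge0.
  by apply: lee_sum => i iS; exact: hsum.
by rewrite EFinM lee_pmul2l// lte_fin.
Qed.

End hypercube.

(** * Parameters on the first coordinate axis *)

Section axis.
Context {R : realType} {d : nat}.
Local Notation V := 'rV[R]_d.+1.

Definition axis (a : R) : V := a *: delta_mx ord0 ord0.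

Lemma axisE a k : axis a ord0 k = if k == ord0 then a else 0.
Proof. by rewrite !mxE eqxx/=; case: eqP; rewrite ?mulr1 ?mulr0. Qed.

Lemma axis_inj : injective axis.
Proof. by move=> a b /(congr1 (fun v : V => v ord0 ord0)); rewrite !axisE eqxx. Qed.

Definition axis_tuple n (s : 'I_n -> R) : n.-tuple V := [tuple axis (s i) | i < n].

Lemma gauss_ratio_axis a b (x : V) : gauss_ratio (axis a) (axis b) x =
  expR ((b - a) * (x ord0 ord0 - a) - (b - a) ^+ 2 / 2).
Proof.
rewrite /gauss_ratio (bigD1 ord0)//= !axisE eqxx big1 ?mulr1// => k k0.
by rewrite !axisE (negbTE k0) subrr mul0r expr0n/= mul0r subr0 expR0.
Qed.

Lemma sample_ratio_axis n (s s' : 'I_n -> R) (X : n.-tuple V) :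
  sample_ratio (axis_tuple s) (axis_tuple s') X =
  \prod_(i < n) expR ((s' i - s i) * (tnth X i ord0 ord0 - s i) - (s' i - s i) ^+ 2 / 2).
Proof. by apply: eq_bigr => i _; rewrite !tnth_mktuple gauss_ratio_axis. Qed.

Lemma gauss_density_axis a b (x : V) :
  gauss_density (x - axis b) = gauss_density (x - axis a) *
    expR (((x ord0 ord0 - a) ^+ 2 - (x ord0 ord0 - b) ^+ 2) / 2).
Proof.
rewrite /gauss_density -mulrA -expRD; congr (_ * expR _).
have sE c : enorm (x - axis c) ^+ 2 = (x ord0 ord0 - c) ^+ 2 +
    \sum_(k < d.+1 | k != ord0) x ord0 k ^+ 2.
  have subE k : (x - axis c) ord0 k = x ord0 k - axis c ord0 k by rewrite !mxE.
  rewrite sqr_enorm (bigD1 ord0)//= subE axisE eqxx; congr (_ + _).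
  by apply: eq_bigr => k k0; rewrite subE axisE (negbTE k0) subr0.
by rewrite !sE; field.
Qed.

Lemma oracle_axisB n (s : 'I_n -> R) (c : R) (x : V) : (0 < n)%N ->
  oracle_bayes (axis_tuple s) x ord0 ord0 - c =
  (\sum_(i < n) gauss_density (x - axis (s i)) * (s i - c)) /
  \sum_(i < n) gauss_density (x - axis (s i)).
Proof.
move=> n0; have S0 := sum_gauss_density_gt0 (axis_tuple s) x n0.
rewrite oracle_bayesE//.
under eq_bigr do rewrite tnth_mktuple axisE eqxx.
have SE : \sum_(i < n) gauss_density (x - tnth (axis_tuple s) i) =
    \sum_(i < n) gauss_density (x - axis (s i)).
  by apply: eq_bigr => i _; rewrite tnth_mktuple.
rewrite SE; rewrite SE in S0.
under [in RHS]eq_bigr do rewrite mulrBr.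
rewrite sumrB -mulr_suml.
by field; rewrite gt_eqF.
Qed.

(** With [y = x - a] and [z = x - b], this bounds the pull that a far parameter [b]
    exerts on the posterior mean near [a]: distance times relative weight. For
    [E = |y - z|] the exponent is at most [(1 - (E - 1) ^ 2) / 2 <= - E ^ 2 / 4], and
    [E * expR (- E ^ 2 / 4) <= 4 / E]. The threshold [16 * n] makes [n] such pulls
    add up to at most [1 / 4]. *)
Lemma gaussian_tail_small (n : nat) (y z : R) : (0 < n)%N ->
  16 * n%:R <= `|y - z| -> `|y| <= 1 ->
  `|y - z| * expR ((y ^+ 2 - z ^+ 2) / 2) <= (4 * n%:R)^-1.
Proof.
move=> n0; set E := `|y - z| => E16 y1.
have n1 : 1 <= n%:R :> R by rewrite ler1n.
have zE : E - 1 <= `|z|.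
  have := ler_normB y z; rewrite -/E; lra.
have z2 : (E - 1) ^+ 2 <= z ^+ 2.
  by rewrite -[leRHS]real_normK ?num_real// lerXn2r ?nnegrE//; lra.
have y2 : y ^+ 2 <= 1.
  by rewrite -[leLHS]real_normK ?num_real// expr_le1.
have E0 : 0 < E by lra.
have expo : (y ^+ 2 - z ^+ 2) / 2 <= - (E ^+ 2 / 4).
  by move: z2; rewrite !expr2 in y2 *; nra.
apply: (@le_trans _ _ (E * (E ^+ 2 / 4)^-1)).
  rewrite ler_wpM2l ?(ltW E0)//; apply: (@le_trans _ _ (expR (- (E ^+ 2 / 4)))).
    by rewrite ler_expR.
  rewrite expRN lef_pV2 ?posrE ?expR_gt0//; last first.
    by rewrite divr_gt0// exprn_gt0.
  by apply: le_trans (expR_ge1Dx _); rewrite lerDr.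
have -> : E * (E ^+ 2 / 4)^-1 = 4 / E by field; rewrite gt_eqF.
rewrite ler_pdivrMr// mulrC ler_pdivlMr ?mulr_gt0 ?ltr0n//.
lra.
Qed.

(** Near a parameter that is far from all the others, the posterior puts almost all
    its mass on that parameter, so the oracle reveals it up to [1 / 4]. *)
Lemma oracle_close n (s : 'I_n -> R) (i : 'I_n) (x : V) :
  (forall l, l != i -> 16 * n%:R <= `|s l - s i|) ->
  `|x ord0 ord0 - s i| <= 1 ->
  `|oracle_bayes (axis_tuple s) x ord0 ord0 - s i| <= 1 / 4.
Proof.
move=> sep xi.
have n0 : (0 < n)%N by case: i {sep xi}; case: n s.
rewrite oracle_axisB//.
set S := \sum_(l < n) gauss_density _.
set g := gauss_density (x - axis (s i)).
have g0 : 0 < g by exact: gauss_density_gt0.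
have gS : g <= S.
  rewrite /S (bigD1 i)//= lerDl; apply: sumr_ge0 => l _.
  exact/ltW/gauss_density_gt0.
have S0 : 0 < S by exact: lt_le_trans gS.
rewrite normrM normfV (gtr0_norm S0) ler_pdivrMr//.
apply: (le_trans (ler_norm_sum _ _ _)).
apply: (@le_trans _ _ (\sum_(l < n) g * (4 * n%:R)^-1)); last first.
  rewrite sumr_const card_ord -[_ *+ n]mulr_natr.
  have -> : g * (4 * n%:R)^-1 * n%:R = 1 / 4 * g.
    by field; rewrite pnatr_eq0 -lt0n.
  by rewrite ler_wpM2l.
apply: ler_sum => l _; have [->|li] := eqVneq l i.
  rewrite subrr mulr0 normr0; apply: mulr_ge0; first exact: ltW.
  by rewrite invr_ge0 mulr_ge0.
rewrite normrM (gtr0_norm (gauss_density_gt0 _)) (gauss_density_axis (s i)) -/g.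
rewrite -mulrA ler_wpM2l ?(ltW g0)// mulrC.
have -> : s l - s i = (x ord0 ord0 - s i) - (x ord0 ord0 - s l) by ring.
apply: gaussian_tail_small => //.
by rewrite (_ : _ - _ - _ = s l - s i) ?sep//; ring.
Qed.

End axis.

(** * All parameters equal *)

Section one_cluster.
Context {R : realType} {d : nat}.
Local Notation V := 'rV[R]_d.+1.

Lemma oracle_bayes_const n (a : R) (x : V) : (0 < n)%N ->
  oracle_bayes (axis_tuple (fun _ : 'I_n => a)) x ord0 ord0 = a.
Proof.
move=> n0; apply/eqP; rewrite -subr_eq0 oracle_axisB//.
by rewrite big1 ?mul0r// => i _; rewrite subrr mulr0.
Qed.

Lemma undup_axis_const n (a : R) : (0 < n)%N ->
  size (undup (axis_tuple (fun _ : 'I_n => a) : seq V)) = 1%N.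
Proof.
move=> n0; rewrite (_ : size _ = size [:: axis a : V])//.
apply: perm_size; apply: uniq_perm; rewrite ?undup_uniq// => v.
rewrite mem_undup inE; apply/tnthP/eqP => [[i ->]|->].
  by rewrite tnth_mktuple.
by exists (Ordinal n0); rewrite tnth_mktuple.
Qed.

(** A common value is shifted by [dl = n ^ (-1/2)] or not. The oracle equals the
    common value, so the targets are [dl] apart, while the samples are at bounded
    divergence. To see that the likelihood ratio [L] of the shift is not small, use
    the ratio [L'] of the opposite shift: [L * L'] is the constant
    [expR (- n * dl ^ 2) = expR (- 1)], and [L' <= 2] with probability at least 1/2
    ([density_le2_prob]), in which case [L >= expR (- 1) / 2]. *)
Lemma minimax_risk_one_cluster n : (0 < n)%N ->
  ((expR (- 1) / 16 * (1 / n%:R))%:E <= minimax_risk (Theta_class R n d.+1 1))%E.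
Proof.
move=> n0; have n0R : 0 < n%:R :> R by rewrite ltr0n.
have [dl dl0 dl2] : exists2 dl : R, 0 <= dl & dl ^+ 2 = n%:R^-1.
  exists (Num.sqrt n%:R)^-1; first by rewrite invr_ge0 sqrtr_ge0.
  by rewrite exprVn sqr_sqrtr// ltW.
pose th (a : R) := axis_tuple (fun _ : 'I_n => a) : n.-tuple V.
pose theta (e : {ffun unit -> bool}) := th (if e tt then dl else 0).
have thetaT e : Theta_class R n d.+1 1 (theta e) by exact: undup_axis_const.
have -> : expR (- 1) / 16 * (1 / n%:R) =
    (expR (- 1) / 2 * dl ^+ 2 / 2 * (1 / 2)) * #|[set: 'I_n]%SET|%:R / (2 * n%:R) :> R.
  by rewrite cardsT card_ord dl2; field; rewrite gt_eqF.
apply: (@hypercube_bound R n d.+1 unit theta _ _ (fun=> tt) ord0 _ n0 thetaT).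
move=> g i e mg _ ett.
rewrite /theta ett ffunE eqxx ett /=.
have LD := has_density_sample_law (th 0) (th dl).
have LD' := has_density_sample_law (th 0) (th (- dl)).
have mL' : measurable_fun [set: n.-tuple V] (sample_ratio (th 0) (th (- dl))) by case: LD'.
pose A := [set X : n.-tuple V | sample_ratio (th 0) (th (- dl)) X <= 2].
have mA : measurable A.
  have := mL' measurableT `]-oo, 2]%classic (measurable_itv _).
  by rewrite setTI; congr measurable; apply/seteqP; split => X /=; rewrite in_itv.
have oE a (X : n.-tuple V) : oracle_bayes (th a) (tnth X i) ord0 ord0 = a.
  exact: oracle_bayes_const.
have sep a b : a = 0 -> b = dl -> dl <= `|a - b|.
  by move=> -> ->; rewrite sub0r normrN ger0_norm.
have LL' X : sample_ratio (th 0) (th dl) X * sample_ratio (th 0) (th (- dl)) X = expR (- 1).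
  rewrite !sample_ratio_axis -big_split/=.
  under eq_bigr => k _.
    rewrite -expRD.
    rewrite [X in expR X](_ : _ = - n%:R^-1); last by rewrite -dl2; field.
    over.
  by rewrite prodr_const card_ord -expRM_natl mulrN mulfV ?gt_eqF.
apply: le_trans; last first.
  apply: (@two_point_bound _ _ _ _ _ _ g
    (fun X => oracle_bayes (th 0) (tnth X i) ord0 ord0)
    (fun X => oracle_bayes (th dl) (tnth X i) ord0 ord0) A (expR (- 1) / 2) dl LD) => //.
  - exact: measurable_oracle_coord.
  - exact: measurable_oracle_coord.
  - rewrite divr_ge0 ?expR_ge0//= ler_pdivrMr// mul1r.
    by apply: (@le_trans _ _ (expR 0)); rewrite ?ler_expR ?expR0; lra.
  - move=> X; rewrite /A/= -(LL' X) => L2.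
    have L0 : 0 <= sample_ratio (th 0) (th dl) X by case: LD.
    by rewrite ler_pdivrMr// ler_wpM2l.
  - by move=> X _; exact: (sep _ _ (oE 0 X) (oE dl X)).
rewrite dl2 EFinM lee_wpmul2l//; last exact: density_le2_prob LD'.
Qed.

End one_cluster.

(** * Isolated parameters, each with a free bit *)

Section spread.
Context {R : realType} {d n m : nat}.
Local Notation V := 'rV[R]_d.+1.

(** The first [m] parameters are isolated and each is shifted by its own bit; the
    remaining [n - m] share the site [32 * n * m], so there are [m + 1] distinct
    values. The spacing [32 * n], less the unit shift, leaves the gap [16 * n]
    required by [oracle_close]. *)
Definition spread_pos (e : {ffun 'I_n -> bool}) (i : 'I_n) : R :=
  32 * n%:R * (minn i m)%:R + ((i < m)%N && e i)%:R.

Lemma spread_posP e (p q : 'I_n) : minn p m != minn q m ->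
  16 * n%:R <= `|spread_pos e p - spread_pos e q|.
Proof.
wlog pq : p q / (minn p m < minn q m)%N => [H|_].
  move=> pq; have := pq; rewrite neq_ltn => /orP[|] lt; first exact: H.
  by rewrite distrC; apply: H => //; rewrite eq_sym.
have n1 : 1 <= n%:R :> R by rewrite ler1n (leq_ltn_trans _ (ltn_ord p)).
have pq1 : (minn p m)%:R + 1 <= (minn q m)%:R :> R by rewrite natr1 ler_nat.
have bit (i : 'I_n) : 0 <= (((i < m)%N && e i)%:R : R) <= 1.
  by rewrite ler0n lern1 leq_b1.
have /andP[p0 p1] := bit p; have /andP[q0 q1] := bit q.
rewrite distrC; apply: le_trans (ler_norm _); rewrite /spread_pos.
have : 32 * n%:R * ((minn p m)%:R + 1) <= 32 * n%:R * (minn q m)%:R :> R.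
  by rewrite ler_wpM2l// mulr_ge0.
rewrite mulrDr mulr1.
lra.
Qed.

Lemma eq_spread_pos e (p q : 'I_n) :
  (spread_pos e p == spread_pos e q) = (minn p m == minn q m).
Proof.
apply/eqP/eqP => [pq|].
  apply/eqP/negPn/negP => /(spread_posP e); rewrite pq subrr normr0.
  have n0 : (0 < n)%N by exact: leq_ltn_trans (ltn_ord p).
  by rewrite leNgt mulr_gt0// ltr0n.
rewrite /spread_pos => pq; rewrite pq; congr (_ + _%:R); congr nat_of_bool.
have [pm|mp] := ltnP p m; have [qm|mq] := ltnP q m => //=.
- by congr (e _); apply: val_inj; move: pq; rewrite !(minn_idPl (ltnW _)).
- by have := ltnn m; rewrite -{1}(minn_idPr mq) -pq (minn_idPl (ltnW pm)) pm.
- by have := ltnn m; rewrite -{1}(minn_idPr mp) pq (minn_idPl (ltnW qm)) qm.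
Qed.

Lemma Theta_class_spread (mn : (m < n)%N) e :
  Theta_class R n d.+1 m.+1 (axis_tuple (spread_pos e)).
Proof.
pose F (p : 'I_m.+1) : V := axis (spread_pos e (widen_ord mn p)).
have Finj : injective F.
  move=> p q /axis_inj /eqP; rewrite eq_spread_pos /= => /eqP.
  have mE (r : 'I_m.+1) : minn r m = r by apply/minn_idPl; rewrite -ltnS.
  by rewrite !mE; exact: val_inj.
rewrite /Theta_class /mkset -[RHS](card_ord m.+1) -(size_codom F).
apply: perm_size; apply: uniq_perm; first exact: undup_uniq.
  by rewrite /codom /image_mem map_inj_uniq ?enum_uniq.
move=> v; rewrite mem_undup; apply/tnthP/codomP => [[i ->]|[p ->]].
  have im : (minn i m < m.+1)%N by rewrite ltnS geq_minr.
  exists (Ordinal im); rewrite /F /axis_tuple tnth_mktuple; congr axis.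
  by apply/eqP; rewrite eq_spread_pos /= (minn_idPl (geq_minr i m)).
by exists (widen_ord mn p); rewrite /axis_tuple tnth_mktuple.
Qed.

(** Flipping the bit [i] moves one isolated parameter by 1, hence the oracle at [X_i]
    by at least [1 - 1/4 - 1/4 = 1/2] as soon as [X_i] falls between the two values;
    there the likelihood ratio [expR (X_i - a - 1/2)] is at least [expR (- 1/2)]. *)
Lemma minimax_risk_spread : (m < n)%N ->
  ((expR (- 1 / 2) * (1 / 2) ^+ 2 / 2 * (normal_peak 1 * expR (- 1 / 2)) * m%:R / (2 * n%:R))%:E
     <= minimax_risk (Theta_class R n d.+1 m.+1))%E.
Proof.
move=> mn; have n0 : (0 < n)%N by exact: leq_ltn_trans mn.
pose S := [set i : 'I_n | (i < m)%N]%SET.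
have Sm : #|S| = m.
  rewrite -[RHS]card_ord -(card_imset _ (f := widen_ord (ltnW mn))); last first.
    by move=> p q /(congr1 val)/= /val_inj.
  apply: eq_card => i; rewrite !inE; apply/idP/imsetP => [im|[p _ ->]].
    by exists (Ordinal im) => //; exact: val_inj.
  exact: (ltn_ord p).
rewrite (_ : m%:R = #|S|%:R); last by rewrite Sm.
apply: (@hypercube_bound R n d.+1 'I_n (fun e => axis_tuple (spread_pos e)) _ S id ord0 _ n0).
  by move=> e; exact: Theta_class_spread.
move=> g i e mg; rewrite inE => im ei.
set e' := flip i e.
pose a := spread_pos e i.
have aE' : spread_pos e' i = a + 1.
  by rewrite /a /spread_pos ffunE eqxx ei im /= addr0.
have sE' l : l != i -> spread_pos e' l = spread_pos e l.
  by move=> li; rewrite /spread_pos ffunE (negbTE li).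
have sep (f : {ffun 'I_n -> bool}) l : l != i ->
    16 * n%:R <= `|spread_pos f l - spread_pos f i|.
  move=> li; apply: spread_posP; apply: contra li => /eqP.
  rewrite [minn i m](minn_idPl (ltnW im)) /minn.
  case: ltnP => [_ li|_ mi]; first by apply/eqP; exact: val_inj.
  by move: im; rewrite -mi ltnn.
have far (u v : R) : `|u - a| <= 1 / 4 -> `|v - (a + 1)| <= 1 / 4 ->
    1 / 2 <= `|u - v|.
  rewrite !ler_norml => /andP[? ?] /andP[? ?].
  by have := ler_norm (v - u); rewrite distrC; lra.
pose A := [set X : n.-tuple V | `[a, a + 1]%classic (tnth X i ord0 ord0)].
have mA : measurable A.
  have := measurable_sample_coord (d := d.+1) i ord0 measurableT (measurable_itv `[a, a + 1]).
  by rewrite setTI.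
have PA : ((normal_peak 1 * expR (- 1 / 2))%:E <=
    sample_law (axis_tuple (spread_pos e)) A)%E.
  rewrite /A sample_law_coord; last exact: measurable_itv.
  rewrite tnth_mktuple axisE eqxx; exact: normal_prob_itv_ge.
have LD := has_density_sample_law (axis_tuple (spread_pos e) : n.-tuple V) (axis_tuple (spread_pos e')).
have LE (X : n.-tuple V) : sample_ratio (axis_tuple (spread_pos e)) (axis_tuple (spread_pos e')) X =
    expR (tnth X i ord0 ord0 - a - 1 / 2).
  rewrite sample_ratio_axis (bigD1 i)//= big1 ?mulr1; last first.
    by move=> l li; rewrite sE'// subrr mul0r expr0n/= mul0r subr0 expR0.
  by congr expR; rewrite aE' -/a; field.
apply: (@le_trans _ _ ((expR (- 1 / 2) * (1 / 2) ^+ 2 / 2)%:E * sample_law (axis_tuple (spread_pos e)) A)%E).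
  by rewrite EFinM lee_wpmul2l// lee_fin !mulr_ge0 ?expR_ge0 ?exprn_ge0.
apply: (@two_point_bound _ _ _ _ _ _ g
    (fun X => oracle_bayes (axis_tuple (spread_pos e)) (tnth X i) ord0 ord0)
    (fun X => oracle_bayes (axis_tuple (spread_pos e')) (tnth X i) ord0 ord0)
    A (expR (- 1 / 2)) (1 / 2) LD) => //.
- exact: measurable_oracle_coord.
- exact: measurable_oracle_coord.
- by rewrite expR_ge0/= -[leRHS]expR0 ler_expR; lra.
- move=> X; rewrite /A/= in_itv/= LE ler_expR => /andP[aX _]; lra.
- move=> X; rewrite /A/= in_itv/= => /andP[aX Xa].
  have h1 : `|oracle_bayes (axis_tuple (spread_pos e)) (tnth X i) ord0 ord0 - a| <= 1 / 4.
    by apply: oracle_close; [exact: sep|rewrite -/a ger0_norm; lra].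
  have h2 : `|oracle_bayes (axis_tuple (spread_pos e')) (tnth X i) ord0 ord0 - (a + 1)| <= 1 / 4.
    rewrite -aE'; apply: oracle_close; first exact: sep.
    by rewrite aE' ler0_norm; lra.
  exact: far h1 h2.
Qed.

End spread.

(** * The minimax lower bound *)

Theorem lemma3p4 (R : realType) :
  exists C : R, 0 < C /\
    forall d n k : nat, (1 <= d)%N -> (2 <= n)%N -> (1 <= k <= n)%N ->
      ((C * (k%:R / n%:R))%:E <= minimax_risk (Theta_class R n d k))%E.
Proof.
pose c : R := expR (- 1 / 2) * (1 / 2) ^+ 2 / 2 * (normal_peak 1 * expR (- 1 / 2)).
have c0 : 0 < c.
  by rewrite !mulr_gt0 ?expR_gt0 ?exprn_gt0 ?normal_peak_gt0 ?oner_neq0.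
exists (Num.min (c / 4) (expR (- 1) / 16)); split.
  by rewrite lt_min !divr_gt0 ?expR_gt0.
move=> [//|d] n [//|k] _ n2 /= kn.
have n0 : (0 < n)%N by exact: ltn_trans n2.
have n0R : 0 < n%:R :> R by rewrite ltr0n.
have [->|k0] := posnP k.
  apply: le_trans (minimax_risk_one_cluster (d := d) n0).
  by rewrite lee_fin ler_wpM2r ?divr_ge0 ?ge_min ?lexx ?orbT// ltW.
apply: le_trans (minimax_risk_spread (d := d) kn).
rewrite lee_fin -/c; apply: (@le_trans _ _ (c / 4 * (k.+1%:R / n%:R))).
  by rewrite ler_wpM2r ?divr_ge0 ?ge_min ?lexx// ltW.
(* Of [k.+1] distinct values only [k] are isolated, and [k >= (k + 1) / 2]. *)
rewrite -subr_ge0.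
have -> : c * k%:R / (2 * n%:R) - c / 4 * (k.+1%:R / n%:R) = c * (k%:R - 1) / (4 * n%:R).
  by rewrite -natr1; field; rewrite gt_eqF.
apply: divr_ge0; last by rewrite mulr_ge0 ?ltW.
by apply: mulr_ge0; [exact: ltW|rewrite subr_ge0 ler1n].
Qed.
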